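(* Let $\varepsilon>0$, and suppose $p\le\left(\frac{1-\varepsilon}{\sqrt2}\right)^n$. Let $P_p$ be a random $0/1$ polytope, and let $G_p$ be its associated graph. Then, with high probability, every vertex $v\in V(G_p)$ satisfies $$\deg(v)=(1-o(1))\cdot|V(G_p)|.$$
   Context: For $n\ge 1$ and a probability parameter $0\le p\le 1$, which may vary with $n$, $Q_p^n\subseteq\{0,1\}^n$ is the random subset obtained by including each point of $\{0,1\}^n$ independently with probability $p$. The random $0/1$ polytope is $P_p=\operatorname{conv}(Q_p^n)\subset\mathbb{R}^n$. Its associated graph ($1$-skeleton) $G_p$ is the undirected graph with vertex set $V(G_p)=Q_p^n$ (the vertices of $P_p$) and edge set the set of $1$-faces (one-dimensional faces) of $P_p$: two distinct vertices $x,y$ are adjacent if and only if the segment $[x,y]$ is a $1$-face of $P_p$. A face of a polytope is its intersection with a supporting hyperplane, that is, a hyperplane that meets the polytope and has the polytope contained in one of its closed halfspaces. The degree of a vertex $v$ in $G_p$ is denoted $\deg(v)$. ''With high probability'' means with probability tending to $1$ as $n\to\infty$, and $o(1)$ denotes a quantity tending to $0$ as $n\to\infty$.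
   Formalization: False as printed for p=2^{-n} (|V|=1 with probability tending to 1/e, degree 0); deg(v)=(1-o(1))|V| is proved under the necessary condition Pr(1≤|V|≤K)→0 for every fixed K, and deg(v)=(1-o(1))(|V|-1) is proved for every allowed p. *)

(* Defs.v *)
From HB Require Import structures.
From mathcomp Require Import all_boot all_order all_algebra.
From mathcomp Require Import all_classical all_reals all_analysis.
Import numFieldNormedType.Exports.
Set Implicit Arguments.
Unset Strict Implicit.
Unset Printing Implicit Defensive.
Import Order.TTheory GRing.Theory Num.Theory.
Local Open Scope classical_set_scope.
Local Open Scope ring_scope.

Definition cube (n : nat) := {ffun 'I_n -> bool}.

Definition cube_vec (R : realType) (n : nat) (x : cube n) : 'rV[R]_n :=
  \row_i (x i)%:R.
Arguments cube_vec R {n} x.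

Definition conv_hull (R : realType) (n : nat) (S : set 'rV[R]_n) :
    set 'rV[R]_n :=
  smallest (@convex_set R 'rV[R]_n) S.

Definition polytope (R : realType) (n : nat) (Q : {set cube n}) :
    set 'rV[R]_n :=
  conv_hull [set cube_vec R x | x in [set` Q]].
Arguments polytope R {n} Q.

Definition segment (R : realType) (n : nat) (u v : 'rV[R]_n) : set 'rV[R]_n :=
  [set (1 - t) *: u + t *: v | t in `[0, 1]].

Definition dotv (R : realType) (n : nat) (a u : 'rV[R]_n) : R :=
  \sum_(i < n) a 0 i * u 0 i.

(* The hyperplane [dotv a u = b] (with [a != 0]) supports [P], and [F] is its
   intersection with [P]. *)
Definition is_face (R : realType) (n : nat) (P F : set 'rV[R]_n) : Prop :=
  exists (a : 'rV[R]_n) (b : R),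
    let H := [set u | dotv a u = b] in
    [/\ a != 0, P `&` H !=set0, P `<=` [set u | dotv a u <= b]
      & F = P `&` H].

(* As [x != y], the segment is one-dimensional, so a face equal to it is a
   1-face. *)
Definition adjacent (R : realType) (n : nat) (Q : {set cube n})
    (x y : cube n) : Prop :=
  [/\ x \in Q, y \in Q, x != y &
      is_face (polytope R Q) (segment (cube_vec R x) (cube_vec R y))].
Arguments adjacent R {n} Q x y.

Definition deg (R : realType) (n : nat) (Q : {set cube n}) (v : cube n) : nat :=
  #|[pred y | `[< adjacent R Q v y >]]|.
Arguments deg R {n} Q v.

(* Law of the random subset containing each point independently with
   probability [p]: the probability of the event [E]. *)
Definition random_subset_prob (R : realType) (n : nat) (p : R)
    (E : set {set cube n}) : R :=
  \sum_(Q : {set cube n} | `[< E Q >])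
    \prod_(x : cube n) (if x \in Q then p else 1 - p).

Definition whp (R : realType) (p : nat -> R)
    (E : forall n, set {set cube n}) : Prop :=
  random_subset_prob (p n) (E n) @[n --> \oo] --> (1 : R).

(* [|V(G_p)|], when it is nonzero, tends to infinity in probability. This
   covers both [2^n * p n --> +oo] and [2^n * p n --> 0]. It fails when, e.g.,
   [p n = 2^-n]: then [|V(G_p)| = 1] with probability tending to [1/e], and a
   lone vertex has degree [0], not [(1 - o(1)) * 1]. *)
Definition vertices_unbounded (R : realType) (p : nat -> R) : Prop :=
  forall K : nat,
    random_subset_prob (p n) [set Q : {set cube n} | (0 < #|Q| <= K)%N]
      @[n --> \oo] --> (0 : R).

(* Main.v *)
Require Import Defs.
From HB Require Import structures.
From mathcomp Require Import all_boot all_order all_algebra.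
From mathcomp Require Import all_classical all_reals all_analysis.
From mathcomp Require Import ring lra.
Import numFieldNormedType.Exports.
Import Order.TTheory GRing.Theory Num.Theory.
Local Open Scope classical_set_scope.
Local Open Scope ring_scope.
Set Implicit Arguments.
Unset Strict Implicit.
Unset Printing Implicit Defensive.

(** Let [x] and [y] be two points of [Q], and let [F] be the smallest face
    of the cube containing both. If [F] is proper and contains no third
    point of [Q], then the linear form counting, up to a constant, the
    agreements with [x] on the coordinates common to [x] and [y] is maximal
    on the polytope exactly along the segment, so [x] and [y] are adjacent
    ([adjacent_isolated]). The deficit of the degree of [v] is thus at most
    the number of [y] in [Q] that are antipodal to [v] or for which some
    third point [z] of [Q] lies between [v] and [y]. The face of [v] and
    [y] has [2 ^ dist v y] points, the distance is typically close to [n /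
    2], and [p * 2 ^ (n / 2)] is exponentially small: this is the origin of
    the square root of 2. What remains is uniformity in [v].

    When [p <= (11 / 20) ^ n], there is with high probability no
    obstruction at all: the cube has [6 ^ n] triples [(v, y, z)] with [z]
    between [v] and [y], and [6 ^ n * p ^ 3] tends to 0
    ([prob_some_nonneighbor]).

    When [p > (11 / 20) ^ n], the expected size [2 ^ n * p] of [Q] is
    exponentially large. Chernoff bounds with failure probability [exp (- 3
    n)] then hold simultaneously for all pairs of points, at the price of
    an additive error linear in [n] ([prob_irregular]). Moreover [2 ^ n * p
    ^ 2] is exponentially small, so that all distances in [Q] exceed [2 d
    n] for a small constant [d] ([prob_crowded]). Few [y] in [Q] have
    distance at least [(1 / 2 + d) n] from [v]. If [y] is closer and [z]
    lies between [v] and [y], then [dist v z = dist v y - dist z y] lies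
    between [2 d n] and [(1 / 2 - d) n]. The upper bound leaves few [z]; by
    the lower one, each of them is between [v] and at most [2 ^ n * exp (-
    d n)] points. Applying the concentration bounds first to the [y] hidden
    by a given [z] and then to the sum over [z] bounds the number of
    non-neighbors by [p * 2 ^ n] times an exponentially small factor
    ([regular_nonneighbors]), whereas [Q] has at least [p * 2 ^ n / 4]
    points.

    Both regimes give a failure probability and a relative deficit of order
    [1 / n] with respect to [#|Q| - 1] ([exceptional_prob]). If the number
    of vertices is unbounded in probability, then a diagonal argument
    ([diagonal_threshold]) makes it exceed, with high probability, some [k
    n] tending to infinity whenever it is nonzero, and [#|Q| - 1] may be
    replaced by [#|Q|]. *)

(** * Adjacency in a 0/1 polytope *)

Definition dist (n : nat) (x y : cube n) : nat := #|[set i | x i != y i]%SET|.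

(** [z] lies in the smallest face of the cube that contains [x] and [y]. *)
Definition between (n : nat) (x y z : cube n) : bool :=
  [forall i, (x i == y i) ==> (z i == x i)].

(** The first condition excludes antipodal pairs: the only cube face containing
    both points is then the whole cube, which no nonzero linear form exposes. *)
Definition isolated_pair (n : nat) (Q : {set cube n}) (x y : cube n) : bool :=
  [exists i, x i == y i] && [forall z in Q, between x y z ==> (z \in [:: x; y])].

Section Geometry.
Variable R : realType.

Section Dotv.
Variables (n : nat) (a : 'rV[R]_n).

Lemma dotvD u v : dotv a (u + v) = dotv a u + dotv a v.
Proof. by rewrite -big_split; apply: eq_bigr => i _; rewrite mxE mulrDr. Qed.

Lemma dotvZ c u : dotv a (c *: u) = c * dotv a u.
Proof. by rewrite /dotv mulr_sumr; apply: eq_bigr => i _; rewrite mxE mulrCA. Qed.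

End Dotv.

Lemma convex_setP n (A : set 'rV[R]_n) :
  @convex_set R 'rV[R]_n A <->
  forall u v t, A u -> A v -> 0 < t < 1 -> A (t *: u + (1 - t) *: v).
Proof.
split.
- move=> cA u v t Au Av /andP[t0 t1].
  have t01 : 0 <= t <= 1 by rewrite !ltW.
  have := cA u v (Itv01 (ltW t0) (ltW t1)).
  by rewrite !inE; apply.
- move=> cA; apply/convex_setW => u v /[!inE] Au Av k k0 k1.
  by apply/mem_set; apply: (cA u v k%:num) => //; rewrite k0 k1.
Qed.

Lemma convex_segment n (x y : 'rV[R]_n) : @convex_set R 'rV[R]_n (segment x y).
Proof.
apply/convex_setP => _ _ t [r /= r01 <-] [s /= s01 <-] /andP[t0 t1].
move: r01 s01; rewrite !in_itv /= => /andP[r0 r1] /andP[s0 s1].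
exists (t * r + (1 - t) * s) => /=.
  by rewrite in_itv /=; apply/andP; split; nra.
rewrite !scalerDr !scalerA addrACA -!scalerDl; congr (_ *: _ + _ *: _); ring.
Qed.

Lemma conv_hull_sub n (S : set 'rV[R]_n) : S `<=` conv_hull S.
Proof. exact: sub_gen_smallest. Qed.

Lemma convex_conv_hull n (S : set 'rV[R]_n) : @convex_set R 'rV[R]_n (conv_hull S).
Proof.
apply/convex_setP => u v t Su Sv t01 B [cB SB].
by move/convex_setP: (cB); apply => //; [exact: Su | exact: Sv].
Qed.

(** A linear form attaining its maximum over [S] only at [x] and [y] exposes
    their segment: in a convex combination lying on the hyperplane, both
    points lie on it. *)
Lemma conv_hull_segment_face n (S : set 'rV[R]_n) (a : 'rV[R]_n) (b : R) x y :
  a != 0 -> S x -> S y -> dotv a x = b -> dotv a y = b ->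
  (forall u, S u -> dotv a u <= b) ->
  (forall u, S u -> dotv a u = b -> u = x \/ u = y) ->
  is_face (conv_hull S) (segment x y).
Proof.
move=> a0 Sx Sy ax ay Sle Seq.
pose T := [set u | dotv a u <= b /\ (dotv a u = b -> segment x y u)].
(* A proper convex combination of points of [T] that reaches the hyperplane has
   both of them there. *)
have cT : @convex_set R 'rV[R]_n T.
  apply/convex_setP => u v t [ule useg] [vle vseg] t01.
  have /andP[t0 t1] := t01.
  split => /=; first by rewrite dotvD !dotvZ; nra.
  rewrite dotvD !dotvZ => uvb.
  have ub : dotv a u = b by nra.
  have vb : dotv a v = b by nra.
  by move/convex_setP: (@convex_segment n x y); apply => //; auto.
have hullT : conv_hull S `<=` T.
  apply: smallest_sub => // u Su; split; first exact: Sle.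
  move=> /(Seq _ Su) [->|->].
  - by exists 0; rewrite /= ?in_itv /= ?lexx ?ler01 // subr0 scale1r scale0r addr0.
  - by exists 1; rewrite /= ?in_itv /= ?lexx ?ler01 // subrr scale1r scale0r add0r.
exists a, b; split => //.
- by exists x; split => //; exact: conv_hull_sub.
- by move=> u /hullT[].
- apply/seteqP; split=> [u [t /= t01 <-]|u [/hullT[_ useg] /useg]//].
  split; last by rewrite /= dotvD !dotvZ ax ay; ring.
  move: t01; rewrite in_itv /= => /andP[t0 t1].
  have [xh yh] := (conv_hull_sub Sx, conv_hull_sub Sy).
  have [->|t0'] := eqVneq t 0; first by rewrite subr0 scale1r scale0r addr0.
  have [->|t1'] := eqVneq t 1; first by rewrite subrr scale1r scale0r add0r.
  have /convex_setP := @convex_conv_hull n S.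
  move=> /(_ x y (1 - t) xh yh); rewrite subKr; apply.
  rewrite subr_gt0 lt_neqAle t1' t1 /= ltrBlDr ltrDl lt_neqAle eq_sym t0' //.
Qed.

(** Up to a constant, the linear form counts the agreements with [x] on the
    coordinates where [x] and [y] coincide; it is maximal exactly on the cube
    face of [x] and [y]. *)
Lemma adjacent_isolated n (Q : {set cube n}) (x y : cube n) :
  x \in Q -> y \in Q -> x != y -> isolated_pair Q x y -> Defs.adjacent R Q x y.
Proof.
move=> xQ yQ xy /andP[/existsP[i0 xyi0] /forall_inP iso].
split => //.
pose c i : R := if x i == y i then (if x i then 1 else -1) else 0.
pose a : 'rV[R]_n := \row_i c i.
(* Coordinatewise, equality holds exactly when [z] is as [between] requires. *)
have term (z : cube n) i : c i * (z i)%:R <= c i * (x i)%:R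
    ?= iff ((x i == y i) ==> (z i == x i)).
  rewrite /c; apply/leifP; case: (x i); case: (y i); case: (z i) => /=;
    rewrite ?mulr1 ?mulr0 ?mul0r ?mulN1r //; lra.
have dotE (z : cube n) : dotv a (cube_vec R z) = \sum_i c i * (z i)%:R.
  by apply: eq_bigr => i _; rewrite !mxE.
have leifz (z : cube n) : dotv a (cube_vec R z) <= dotv a (cube_vec R x)
    ?= iff between x y z.
  by rewrite !dotE; apply: leif_sum => i _; exact: term.
apply: (@conv_hull_segment_face _ _ a (dotv a (cube_vec R x))).
- apply/eqP => /rowP /(_ i0); rewrite !mxE /c xyi0; by case: (x i0) => /eqP; rewrite ?oppr_eq0 oner_eq0.
- by exists x.
- by exists y.
- by [].
- apply/eqP; rewrite leifz; apply/forallP => i; apply/implyP => /eqP ->; exact: eqxx.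
- by move=> _ [z zQ <-]; rewrite leifz.
- move=> _ [z zQ <-] /eqP; rewrite leifz => bz.
  have := iso z zQ; rewrite bz /= !inE => /orP[]/eqP ->; by [left|right].
Qed.

End Geometry.

(** * Probability of events on random subsets *)

Definition expectation (R : realType) (n : nat) (p : R)
    (f : {set cube n} -> R) : R :=
  \sum_(Q : {set cube n}) (\prod_(x : cube n) (if x \in Q then p else 1 - p)) * f Q.

Section Probability.
Variables (R : realType) (n : nat) (p : R).
Hypothesis p01 : 0 <= p <= 1.

Local Notation T := (cube n).
Local Notation prob := (@random_subset_prob R n p).
Local Notation E := (@expectation R n p).

Let p0 : 0 <= p. Proof. by case/andP: p01. Qed.
Let p1 : p <= 1. Proof. by case/andP: p01. Qed.

Lemma weight_ge0 (Q : {set T}) :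
  0 <= \prod_(x : T) (if x \in Q then p else 1 - p).
Proof. by apply: prodr_ge0 => x _; case: ifP => _; rewrite ?subr_ge0. Qed.

(** Independence of the points: expectations of products factor. *)
Lemma expectation_prod (g h : T -> R) :
  E (fun Q => \prod_x (if x \in Q then g x else h x)) =
  \prod_x (p * g x + (1 - p) * h x).
Proof.
rewrite bigA_distr; apply: eq_bigr => Q _; rewrite -big_split.
by apply: eq_bigr => x _; case: ifP.
Qed.

Lemma expectation_sum (I : finType) (P : pred I) (f : I -> {set T} -> R) :
  E (fun Q => \sum_(i | P i) f i Q) = \sum_(i | P i) E (f i).
Proof.
rewrite /expectation exchange_big /=; apply: eq_bigr => Q _.
by rewrite mulr_sumr.
Qed.

Lemma expectationZ c (f : {set T} -> R) : E (fun Q => c * f Q) = c * E f.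
Proof. by rewrite /expectation mulr_sumr; apply: eq_bigr => Q _; rewrite mulrCA. Qed.

Lemma probE (A : set {set T}) : prob A = E (fun Q => (`[< A Q >])%:R).
Proof.
rewrite /random_subset_prob big_mkcond; apply: eq_bigr => Q _.
by case: ifP => _; rewrite ?mulr1 ?mulr0.
Qed.

Lemma prob_markov (A : set {set T}) (f : {set T} -> R) :
  (forall Q, 0 <= f Q) -> (forall Q, A Q -> 1 <= f Q) -> prob A <= E f.
Proof.
move=> f0 f1; rewrite probE; apply: ler_sum => Q _.
by apply: ler_wpM2l; [exact: weight_ge0 | case: asboolP => [/f1|_]].
Qed.

Lemma le_prob (A B : set {set T}) : A `<=` B -> prob A <= prob B.
Proof.
move=> AB; rewrite (probE B); apply: prob_markov => Q; first by rewrite ler0n.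
by move/AB => BQ; rewrite (asboolT BQ).
Qed.

Lemma prob_union (I : finType) (A : I -> set {set T}) :
  prob [set Q : {set T} | exists i, A i Q] <= \sum_i prob (A i).
Proof.
under eq_bigr => i _ do rewrite probE.
rewrite -(expectation_sum xpredT); apply: prob_markov => Q.
  by apply: sumr_ge0 => i _; rewrite ler0n.
move=> [i AiQ]; rewrite (bigD1 i) //= (asboolT AiQ) lerDl.
by apply: sumr_ge0 => j _; rewrite ler0n.
Qed.

Lemma prob_union2 (A B : set {set T}) : prob (A `|` B) <= prob A + prob B.
Proof.
have -> : A `|` B = [set Q : {set T} | exists b : bool, (if b then A else B) Q].
  apply/seteqP; split => Q /=.
    by case=> ?; [exists true|exists false].
  by case=> -[] ?; [left|right].
by apply: le_trans (prob_union _) _; rewrite big_bool.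
Qed.

Lemma prob_setT : prob setT = 1.
Proof.
rewrite probE.
have -> : (fun Q : {set T} => (`[< setT Q >])%:R : R) =
          (fun Q => \prod_x (if x \in Q then 1 else 1)).
  apply/funext => Q; rewrite asboolT // big1 // => x _; by case: ifP.
by rewrite expectation_prod big1 // => x _; ring.
Qed.

Lemma prob_setC A : prob (~` A) = 1 - prob A.
Proof.
apply/eqP; rewrite -prob_setT eq_sym subr_eq; apply/eqP.
rewrite !probE /expectation -big_split; apply: eq_bigr => Q _.
rewrite [RHS]/= -mulrDr asboolT // asbool_neg; case: asboolP => _ /=; by rewrite ?addr0 ?add0r.
Qed.

(** The indicator of [S \subset Q] is a product over the points. *)
Lemma prob_subset (S : {set T}) : prob [set Q : {set T} | S \subset Q] = p ^+ #|S|.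
Proof.
rewrite probE.
have -> : (fun Q : {set T} => (`[< [set Q : {set T} | S \subset Q] Q >])%:R : R) =
    (fun Q => \prod_x (if x \in Q then 1 else if x \in S then 0 else 1)).
  apply/funext => Q; rewrite asboolb; have [SQ|/subsetPn[x xS xQ]] := boolP (S \subset Q).
    rewrite big1 // => x _; case: ifP => // xQ; case: ifP => // /(fintype.subsetP SQ).
    by rewrite xQ.
  by rewrite (bigD1 x) //= (negbTE xQ) xS mul0r.
rewrite expectation_prod (bigID (mem S)) /= [X in _ * X]big1 ?mulr1.
  rewrite -prodr_const; apply: eq_bigr => x ->; ring.
by move=> x /negbTE ->; ring.
Qed.

(** A Chernoff bound for weights between [0] and [M]. The exponential is taken
    of the weights divided by [2 * M], hence of arguments [y <= 1 / 2], for
    which [exp y <= 1 + 2 * y]; this is where the factor 2 in front of the mean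
    comes from. A weighted version is needed because the points [z] are later
    counted with the number of points that they hide from [v]. *)
Lemma prob_weight_tail (w : T -> R) (M s : R) : 0 < M ->
  (forall x, 0 <= w x <= M) ->
  prob [set Q : {set T} | 2 * p * (\sum_x w x) + 2 * s * M < \sum_(x in Q) w x]
    <= expR (- s).
Proof.
move=> M0 wM.
have M0' : M != 0 by rewrite gt_eqF.
pose c := expR (- (p * (\sum_x w x) / M) - s).
have c0 : 0 <= c by exact: expR_ge0.
pose f (Q : {set T}) : R :=
  c * \prod_x (if x \in Q then expR (w x / (2 * M)) else 1).
have fE Q : f Q = expR ((\sum_(x in Q) w x) / (2 * M) - p * (\sum_x w x) / M - s).
  rewrite /f -big_mkcond -expR_sum -mulr_suml /c -expRD; congr expR; ring.
apply: (@le_trans _ _ (E f)).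
  apply: prob_markov => Q; rewrite fE ?expR_ge0 //= => h.
  rewrite -[leLHS]expR0 ler_expR -addrA -opprD subr_ge0.
  rewrite ler_pdivlMr ?mulr_gt0 //; apply: le_trans (ltW h).
  by rewrite le_eqVlt; apply/orP; left; apply/eqP; field.
rewrite expectationZ expectation_prod.
apply: (@le_trans _ _ (c * \prod_x expR (p * w x / M))).
  apply: ler_wpM2l => //; apply: ler_prod => x _.
  have /andP[w0 w1] := wM x.
  rewrite mulr1; apply/andP; split.
    by rewrite addr_ge0 ?subr_ge0 // mulr_ge0 ?expR_ge0.
  set y := w x / (2 * M).
  have y0 : 0 <= y by rewrite divr_ge0 // mulr_ge0 // ltW.
  have y1 : y <= 1 / 2.
    rewrite /y ler_pdivrMr ?mulr_gt0 //.
    lra.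
  have ey : expR y <= 1 + 2 * y.
    have h : 1 - y <= expR (- y) by have := @expR_ge1Dx R (- y).
    have e1 : expR y * expR (- y) = 1 by rewrite -expRD subrr expR0.
    have := expR_gt0 y; have := expR_gt0 (- y); nra.
  have -> : p * w x / M = p * (2 * y) by rewrite /y; field.
  by apply: le_trans (expR_ge1Dx _); have := ler_wpM2l p0 ey; lra.
rewrite -expR_sum -mulr_suml -mulr_sumr /c -expRD ler_expR.
by rewrite addrAC addNr add0r.
Qed.

(** Markov's inequality for [2 ^ - #|Q|], whose mean is
    [(1 - p / 2) ^ (2 ^ n)]. *)
Lemma prob_small_card (s : R) :
  prob [set Q : {set T} | #|Q|%:R <= s] <= expR (s - p * 2 ^+ n / 2).
Proof.
pose f (Q : {set T}) : R := expR s * \prod_x (if x \in Q then 1 / 2 else 1).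
have fE Q : f Q = expR s * (1 / 2) ^+ #|Q|.
  by rewrite /f -big_mkcond prodr_const.
apply: (@le_trans _ _ (E f)).
  apply: prob_markov => Q; rewrite fE; first by rewrite mulr_ge0 ?expR_ge0 ?exprn_ge0.
  move=> /= Qs.
  have e12 : expR (-1) <= 1 / 2 :> R.
    rewrite expRN -div1r ler_pdivrMr ?expR_gt0 //.
    have := @expR_ge1Dx R 1; lra.
  apply: (@le_trans _ _ (expR s * expR (-1) ^+ #|Q|)).
    rewrite -expRM_natr -expRD -[leLHS]expR0 ler_expR; lra.
  by rewrite ler_wpM2l ?expR_ge0 // lerXn2r // nnegrE ?expR_ge0 //.
rewrite expectationZ expectation_prod expRD ler_wpM2l ?expR_ge0 //.
rewrite prodr_const card_ffun card_bool card_ord.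
have -> : - (p * 2 ^+ n / 2) = (- (p / 2)) * (2 ^ n)%N%:R by rewrite natrX; field.
rewrite expRM_natr lerXn2r // ?nnegrE ?expR_ge0 //.
  by have := p0; have := p1; lra.
by apply: le_trans (expR_ge1Dx _); lra.
Qed.

End Probability.

(** * Estimates for the exponential function *)

Section ExponentialEstimates.
Variable R : realType.

Lemma expR1_ge2 : 2 <= expR 1 :> R.
Proof. by have := @expR_ge1Dx R 1; lra. Qed.

Lemma expR_half_le2 : expR (1 / 2) <= 2 :> R.
Proof.
have h : 1 / 2 <= expR (- (1 / 2)) :> R by have := @expR_ge1Dx R (- (1 / 2)); lra.
have e1 : expR (1 / 2) * expR (- (1 / 2)) = 1 :> R by rewrite -expRD subrr expR0.
have := expR_gt0 (1 / 2 : R); nra.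
Qed.

Lemma expR_tenth_bound : expR (1 / 20) <= 11 / 10 :> R.
Proof.
have h : 19 / 20 <= expR (- (1 / 20)) :> R by have := @expR_ge1Dx R (- (1 / 20)); lra.
have e1 : expR (1 / 20) * expR (- (1 / 20)) = 1 :> R by rewrite -expRD subrr expR0.
have := expR_gt0 (1 / 20 : R); nra.
Qed.

Lemma ln2_bounds : 0 <= (ln 2 : R) <= 1.
Proof.
rewrite ln_ge0 /=; last lra.
by rewrite -ler_expR lnK ?posrE // expR1_ge2.
Qed.

Lemma expR_le_quadratic (t : R) : `|t| <= 1 / 2 -> expR t <= 1 + t + 2 * t ^+ 2.
Proof.
rewrite ler_norml => /andP[t0 t1].
have h : 1 - t <= expR (- t) by have := @expR_ge1Dx R (- t).
have e1 : expR t * expR (- t) = 1 by rewrite -expRD subrr expR0.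
have et : expR t * (1 - t) <= 1 by rewrite -[leRHS]e1 ler_wpM2l // ?expR_ge0.
rewrite -(@ler_pM2r _ (1 - t)); last by rewrite subr_gt0; lra.
apply: le_trans et _.
have t2 : 0 <= 1 - 2 * t by lra.
by have := mulr_ge0 (sqr_ge0 t) t2; lra.
Qed.

(** Every error term of the proof is dominated by [n ^ 2 * exp (- c n)]; this
    lemma turns it into a multiple of [1 / (n + 1)]. It is the cube of
    [c n / 3 <= exp (c n / 3)]. *)
Lemma sqr_mul_expRN_le (c : R) (n : nat) : 0 < c -> (0 < n)%N ->
  n%:R ^+ 2 * expR (- (c * n%:R)) <= 54 / c ^+ 3 * harmonic n.
Proof.
move=> c0 n0; have n1 : 1 <= n%:R :> R by rewrite ler1n.
set x := n%:R in n1 *.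
have hx : c * x / 3 <= expR (c * x / 3) by have := @expR_ge1Dx R (c * x / 3); lra.
have cube : (c * x / 3) ^+ 3 <= expR (c * x).
  have -> : c * x = (c * x / 3) * 3%:R by field.
  by rewrite expRM_natr mulfK // lerXn2r // nnegrE ?expR_ge0 // divr_ge0 // mulr_ge0; lra.
rewrite expRN /harmonic /= -(natr1 n) -/x.
have E0 := expR_gt0 (c * x).
have c3 : 0 < c ^+ 3 by rewrite exprn_gt0.
rewrite -mulrA -invfM ler_pdivrMr // mulrAC ler_pdivlMr ?mulr_gt0 //; last lra.
move: cube; rewrite expr_div_n exprMn ler_pdivrMr ?exprn_gt0 // => cube.
apply: (@le_trans _ _ (2 * (c ^+ 3 * x ^+ 3))); last lra.
have x3 : x ^+ 2 * (x + 1) <= 2 * x ^+ 3 by rewrite !exprS expr0; nra.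
by have := ler_wpM2l (ltW c3) x3; lra.
Qed.

End ExponentialEstimates.

(** * Counting in the cube *)

Section HammingCube.
Variables (R : realType) (n : nat).
Implicit Types (v x y z : cube n).

Lemma dist_sum x y : dist x y = (\sum_i (x i != y i))%N.
Proof. by rewrite /dist -sum1_card big_mkcond; apply: eq_bigr => i _; rewrite inE; case: ifP. Qed.

Lemma dist_le x y : (dist x y <= n)%N.
Proof. by rewrite -[leqRHS]card_ord; exact: max_card. Qed.

(** A point of the face of [v] and [y] lies on a geodesic from [v] to [y]. *)
Lemma between_dist v y z : between v y z -> dist v y = (dist v z + dist z y)%N.
Proof.
move=> /forallP bz; rewrite !dist_sum -big_split; apply: eq_bigr => i _ /=.
by have := bz i; case: (v i); case: (y i); case: (z i).
Qed.

Lemma prod_dist (a b : R) v y :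
  \prod_i (if v i != y i then a else b) = a ^+ dist v y * b ^+ (n - dist v y).
Proof.
rewrite (bigID (fun i => v i != y i)) /=; congr (_ * _).
  rewrite /dist -prodr_const; apply: eq_big => [i|i ->//]; by rewrite inE.
have -> : (n - dist v y = #|~: [set i | v i != y i]|)%N%SET.
  by rewrite finset.cardsCs finset.setCK card_ord.
rewrite -prodr_const; apply: eq_big => [i|i /negbTE ->//]; by rewrite !inE.
Qed.

Lemma sum_prod_cube (F : 'I_n -> bool -> R) :
  \sum_(y : cube n) \prod_i F i (y i) = \prod_i (F i true + F i false).
Proof.
rewrite -(bigA_distr_bigA F); apply: eq_bigr => i _; exact: big_bool.
Qed.

Lemma sum_exp_dist (a b : R) v :
  \sum_y a ^+ dist v y * b ^+ (n - dist v y) = (a + b) ^+ n.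
Proof.
under eq_bigr => y _ do rewrite -prod_dist.
rewrite (sum_prod_cube (fun i c => if v i != c then a else b)).
rewrite -[in RHS](card_ord n) -prodr_const; apply: eq_bigr => i _.
by case: (v i) => //=; rewrite addrC.
Qed.

Lemma between_natr v y z :
  (between v y z)%:R = \prod_i ((v i == y i) ==> (z i == v i))%:R :> R.
Proof.
have [/forallP bz|] := boolP (between v y z).
  by rewrite big1 // => i _; rewrite bz.
rewrite negb_forall => /existsP[i /negbTE bi].
by rewrite (bigD1 i) //= bi mul0r.
Qed.

Lemma sum_between_mid v y : \sum_z (between v y z)%:R = 2 ^+ dist v y :> R.
Proof.
under eq_bigr => z _ do rewrite between_natr.
rewrite (sum_prod_cube (fun i c => ((v i == y i) ==> (c == v i))%:R)).
transitivity (2 ^+ dist v y * 1 ^+ (n - dist v y) : R); last by rewrite expr1n mulr1.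
rewrite -prod_dist; apply: eq_bigr => i _.
by case: (v i); case: (y i); rewrite /= ?addr0 ?add0r.
Qed.

Lemma sum_between_end v z :
  \sum_y (between v y z)%:R = 2 ^+ (n - dist v z) :> R.
Proof.
under eq_bigr => y _ do rewrite between_natr.
rewrite (sum_prod_cube (fun i c => ((v i == c) ==> (z i == v i))%:R)).
transitivity (1 ^+ dist v z * 2 ^+ (n - dist v z) : R); last by rewrite expr1n mul1r.
rewrite -prod_dist; apply: eq_bigr => i _.
by case: (v i); case: (z i); rewrite /= ?addr0 ?add0r.
Qed.

(** On each coordinate, [2 + 4] of the triples of bits are allowed. *)
Lemma sum_between_triples :
  \sum_(v : cube n) \sum_(y : cube n) \sum_(z : cube n) (between v y z)%:R =
    6 ^+ n :> R.
Proof.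
transitivity (\sum_(v : cube n) 3 ^+ n : R).
  apply: eq_bigr => v _.
  have -> : 3 = 2 + 1 :> R by lra.
  rewrite -(sum_exp_dist _ _ v); apply: eq_bigr => y _.
  by rewrite sum_between_mid expr1n mulr1.
rewrite sumr_const card_ffun card_bool card_ord -[LHS]mulr_natl natrX -exprMn.
by congr (_ ^+ _); rewrite -natrM.
Qed.

Lemma card_le_sum (P : pred (cube n)) (g : cube n -> R) :
  (forall y, 0 <= g y) -> (forall y, P y -> 1 <= g y) ->
  #|P|%:R <= \sum_y g y.
Proof.
move=> g0 g1; rewrite -sum1_card natr_sum big_mkcond; apply: ler_sum => y _.
by case: ifP => [/g1|].
Qed.

(** Hoeffding's moment generating function bound for the distance from [v] to
    a uniform point. *)
Lemma sum_expR_dist (t : R) v : `|t| <= 1 / 2 ->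
  \sum_y expR (t * (2 * (dist v y)%:R - n%:R)) <= 2 ^+ n * expR (2 * t ^+ 2 * n%:R).
Proof.
move=> t12.
have -> : \sum_y expR (t * (2 * (dist v y)%:R - n%:R)) =
          (expR t + expR (- t)) ^+ n.
  rewrite -(sum_exp_dist _ _ v); apply: eq_bigr => y _.
  rewrite -!expRM_natr -expRD natrB ?dist_le //; congr expR; ring.
rewrite expRM_natr -exprMn lerXn2r ?nnegrE ?addr_ge0 ?mulr_ge0 ?expR_ge0 //.
have h1 := expR_le_quadratic t12.
have h2 : expR (- t) <= 1 - t + 2 * t ^+ 2.
  by have := @expR_le_quadratic R (- t); rewrite normrN sqrrN => /(_ t12).
have := @expR_ge1Dx R (2 * t ^+ 2); lra.
Qed.

(** Hoeffding's inequality: [sum_expR_dist] at the optimal parameter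
    [d / 2]. *)
Lemma card_far (d : R) v : 0 <= d <= 1 ->
  #|[pred y | (1 / 2 + d) * n%:R <= (dist v y)%:R]|%:R <=
    2 ^+ n * expR (- (d ^+ 2 / 2 * n%:R)).
Proof.
move=> /andP[d0 d1]; pose t := d / 2.
have t0 : 0 <= t by rewrite divr_ge0.
apply: le_trans (card_le_sum (g := fun y =>
  expR (t * (2 * (dist v y)%:R - n%:R)) * expR (- (2 * t * d * n%:R))) _ _) _.
- by move=> y; rewrite mulr_ge0 ?expR_ge0.
- move=> y /= hy; rewrite -expRD -[leLHS]expR0 ler_expR; nra.
rewrite -mulr_suml.
apply: (@le_trans _ _ (2 ^+ n * expR (2 * t ^+ 2 * n%:R) * expR (- (2 * t * d * n%:R)))).
  by rewrite ler_wpM2r ?expR_ge0 // sum_expR_dist // ger0_norm /t //; lra.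
rewrite -mulrA -expRD ler_pM2l ?exprn_gt0 // ler_expR /t le_eqVlt.
by apply/orP; left; apply/eqP; field.
Qed.

(** The lower tail of the same distribution, at the parameter [- d / 2]. *)
Lemma card_near_half (d : R) v : 0 <= d <= 1 ->
  #|[pred z | (dist v z)%:R <= (1 / 2 - d) * n%:R]|%:R <=
    2 ^+ n * expR (- (d ^+ 2 / 2 * n%:R)).
Proof.
move=> /andP[d0 d1]; pose t := - (d / 2).
have t0 : t <= 0 by rewrite oppr_le0 divr_ge0.
apply: le_trans (card_le_sum (g := fun y =>
  expR (t * (2 * (dist v y)%:R - n%:R)) * expR (2 * t * d * n%:R)) _ _) _.
- by move=> y; rewrite mulr_ge0 ?expR_ge0.
- move=> y /= hy; rewrite -expRD -[leLHS]expR0 ler_expR; nra.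
rewrite -mulr_suml.
apply: (@le_trans _ _ (2 ^+ n * expR (2 * t ^+ 2 * n%:R) * expR (2 * t * d * n%:R))).
  by rewrite ler_wpM2r ?expR_ge0 // sum_expR_dist // ler0_norm /t //; lra.
rewrite -mulrA -expRD ler_pM2l ?exprn_gt0 // ler_expR /t le_eqVlt.
by apply/orP; left; apply/eqP; field.
Qed.

(** A ball whose radius is a small multiple of [n] is exponentially small.
    Writing [t = 2 / e], this is Markov's inequality for [exp (- t * dist)],
    whose sum [(1 + exp (- t)) ^ n] is at most [exp (e / 2 * n)] because
    [exp (- t) <= e / 2]. *)
Lemma card_ball (e : R) v : 0 < e ->
  #|[pred y | (dist v y)%:R <= e ^+ 2 / 4 * n%:R]|%:R <= expR (e * n%:R).
Proof.
move=> e0; pose t := 2 / e.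
have t0 : 0 <= t by rewrite divr_ge0 // ltW.
have et : e * t = 2 by rewrite /t; field; rewrite gt_eqF.
apply: le_trans (card_le_sum (g := fun y =>
  expR (- t) ^+ dist v y * 1 ^+ (n - dist v y) * expR (e / 2 * n%:R)) _ _) _.
- by move=> y; rewrite expr1n !mulr_ge0 ?exprn_ge0 ?expR_ge0.
- move=> y /= hy; rewrite expr1n mulr1 -expRM_natr -expRD -[leLHS]expR0 ler_expR.
  have -> : e / 2 = t * (e ^+ 2 / 4) by rewrite /t; field; rewrite gt_eqF.
  nra.
rewrite -mulr_suml sum_exp_dist.
have -> : e * n%:R = e / 2 * n%:R + e / 2 * n%:R by field.
rewrite [leRHS]expRD ler_wpM2r ?expR_ge0 // expRM_natr lerXn2r ?nnegrE ?addr_ge0 ?expR_ge0 //.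
apply: le_trans (expR_ge1Dx _); rewrite addrC lerD2l expRN.
have h := @expR_ge1Dx R t.
rewrite -div1r ler_pdivrMr ?expR_gt0 //; nra.
Qed.

End HammingCube.

(** * Few points: all pairs are adjacent *)

(** Only candidates: a pair that is not isolated may still be adjacent. *)
Definition nonneighbors (n : nat) (Q : {set cube n}) (v : cube n) : {set cube n} :=
  [set y in Q | (y != v) && ~~ isolated_pair Q v y]%SET.

Section Degree.
Variables (R : realType) (n : nat) (Q : {set cube n}) (v : cube n).
Hypothesis vQ : v \in Q.

Lemma deg_le : (deg R Q v + 1 <= #|Q|)%N.
Proof.
rewrite (cardD1 v) vQ addnC leq_add2l; apply: subset_leq_card.
apply/fintype.subsetP => y; rewrite !inE. move=> [_ yQ vy _].
by rewrite yQ andbT eq_sym.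
Qed.

Lemma le_deg_nonneighbors : (#|Q| <= deg R Q v + #|nonneighbors Q v| + 1)%N.
Proof.
rewrite (cardD1 v) vQ addnC leq_add2r -cardUI; apply: leq_trans (leq_addr _ _).
apply: subset_leq_card; apply/fintype.subsetP => y; rewrite !inE => /andP[yv yQ].
rewrite yQ yv /=; case: (boolP (isolated_pair Q v y)) => iso; rewrite ?orbT //.
by rewrite orbF; apply/asboolP; apply: adjacent_isolated => //; rewrite eq_sym.
Qed.

End Degree.

Section SmallP.
Variables (R : realType) (n : nat) (p : R).
Hypotheses (n0 : (0 < n)%N) (p01 : 0 <= p <= 1).
Local Notation prob := (@random_subset_prob R n p).

Definition antipode (v : cube n) : cube n := [ffun i => ~~ v i].

Lemma antipode_neq v : v != antipode v.
Proof.
apply/eqP => /ffunP /(_ (Ordinal n0)); rewrite ffunE; by case: (v _).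
Qed.

(** First moment bound: a point with a non-neighbor comes from an antipodal
    pair in [Q] or from a triple of [Q] with one point between the others. *)
Lemma prob_some_nonneighbor :
  prob [set Q : {set cube n} | exists2 v, v \in Q & nonneighbors Q v != finset.set0]
    <= 2 ^+ n * p ^+ 2 + 6 ^+ n * p ^+ 3.
Proof.
pose A1 (v : cube n) : set {set cube n} :=
  [set Q : {set cube n} | ([set v; antipode v]%SET \subset Q)].
pose A2 (t : cube n * cube n * cube n) : set {set cube n} :=
  [set Q : {set cube n} | between t.1.1 t.1.2 t.2 /\ #|[set t.1.1; t.1.2; t.2]%SET| = 3
     /\ ([set t.1.1; t.1.2; t.2]%SET \subset Q)].
apply: (@le_trans _ _ (prob ([set Q | exists v, A1 v Q] `|` [set Q | exists t, A2 t Q]))).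
  apply: le_prob => // Q [v vQ /finset.set0Pn[y]].
  rewrite !inE => /and3P[yQ yv]; rewrite negb_and => /orP[|].
    rewrite negb_exists => /forallP nvy; left; exists v; rewrite /A1 /=.
    have -> : antipode v = y.
      apply/ffunP => i; rewrite ffunE; have := nvy i; by case: (v i); case: (y i).
    by apply/fintype.subsetP => u; rewrite !inE => /orP[]/eqP->.
  rewrite negb_forall => /existsP[z]; rewrite !negb_imply !inE negb_or.
  case/and3P => zQ bz /andP[zv zy]; right; exists (v, y, z); split => //=; split.
    rewrite finset.setUC finset.cardsU1 finset.cards2 !inE negb_or zv zy.
    by rewrite eq_sym yv.
  by apply/fintype.subsetP => u; rewrite !inE -orbA => /or3P[]/eqP->.
apply: le_trans (prob_union2 _ _ _) _ => //; apply: lerD.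
  apply: le_trans (prob_union _ _) _ => //.
  under eq_bigr => v _ do rewrite prob_subset finset.cards2 antipode_neq.
  by rewrite sumr_const card_ffun card_bool card_ord -[leLHS]mulr_natl natrX.
apply: le_trans (prob_union _ _) _ => //.
rewrite -(sum_between_triples R n) mulr_suml.
under [leRHS]eq_bigr => v _ do rewrite mulr_suml.
under [leRHS]eq_bigr => v _ do under eq_bigr => y _ do rewrite mulr_suml.
rewrite pair_bigA pair_bigA /=; apply: ler_sum => -[[v y] z] _ /=.
have [bz|nbz] := boolP (between v y z); last first.
  rewrite mul0r /random_subset_prob big_pred0 // => Q.
  by apply/asboolP => -[/=]; rewrite (negbTE nbz).
rewrite mul1r; have [c3|c3] := eqVneq #|[set v; y; z]%SET| 3%N; last first.
  rewrite /random_subset_prob big_pred0 ?exprn_ge0 //; first by case/andP: p01.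
  by move=> Q; apply/asboolP => -[/= _ [/eqP]]; rewrite (negbTE c3).
rewrite -[in leRHS]c3 -prob_subset; apply: le_prob => // Q; by case=> _ [].
Qed.

End SmallP.

(** * Many points: concentration *)

Section LargeP.
Variables (R : realType) (n : nat) (d p : R).
Local Notation T := (cube n).
Local Notation prob := (@random_subset_prob R n p).
Implicit Types v y z : T.

Definition far v y : bool := (1 / 2 + d) * n%:R <= (dist v y)%:R.
Definition mid v z : bool := (dist v z)%:R <= (1 / 2 - d) * n%:R.
Definition away v z : bool := 2 * d * n%:R < (dist v z)%:R.
(** [z] hides [y] from [v]. The far points [y] are discarded, as they are few
    and would be hidden by too many [z]. *)
Definition shaded v z y : bool := between v y z && ~~ far v y.
(** The expectation of [\sum_z shade v z] over [z] in [Q] governs the number of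
    hidden points; the cut-off [away] keeps each term below [max_shade]. *)
Definition shade v z : R := (away v z)%:R * \sum_y (shaded v z y)%:R.

(** The distances from [v] to [z] and from [z] to [y] add up to [dist v y]. As
    [dist z y] exceeds [2 * d * n], a blocking [z] for a point [y] that is not
    far satisfies [mid v z]. *)
Lemma card_nonneighbors_le (Q : {set T}) v : d <= 1 / 2 ->
  {in Q &, forall x y, x != y -> away x y} -> v \in Q ->
  #|nonneighbors Q v|%:R <= \sum_(y in Q) (far v y)%:R +
     \sum_(z in Q | mid v z && away v z) \sum_(y in Q) (shaded v z y)%:R :> R.
Proof.
move=> d2 Qaway vQ.
rewrite exchange_big -big_split /= -sum1_card natr_sum big_mkcond [leRHS]big_mkcond /=.
apply: ler_sum => y _; rewrite !inE.
have [yQ /=|_] := boolP (y \in Q); last by rewrite lexx.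
have s0 (P : pred T) : 0 <= \sum_(z | P z) (shaded v z y)%:R :> R.
  by apply: sumr_ge0 => z _; rewrite ler0n.
case: ifP => [|_]; last by rewrite addr_ge0 ?ler0n.
have [fy|nfy] := boolP (far v y); first by rewrite lerDl s0.
move=> /andP[yv]; rewrite negb_and => /orP[|].
  rewrite negb_exists => /forallP nvy; case/negP: nfy.
  have -> : far v y = true => //; rewrite /far.
  have -> : dist v y = n.
    by rewrite dist_sum (eq_bigr (fun=> 1%N)) ?sum1_card ?card_ord // => i _; rewrite nvy.
  have := ler0n R n; nra.
rewrite negb_forall => /existsP[z]; rewrite !negb_imply !inE negb_or.
case/and3P => zQ bz /andP[zv zy].
have azv : away v z by apply: Qaway => //; rewrite eq_sym.
have azy : away z y by exact: Qaway.
have mz : mid v z.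
  move: nfy azy; rewrite /far /away /mid -ltNge (between_dist bz) natrD; lra.
rewrite (bigD1 z) ?zQ ?mz ?azv //= {1}/shaded bz nfy add0r lerDl.
by apply: sumr_ge0 => u _; rewrite ler0n.
Qed.

(** Failure of the Chernoff bound with [s = 3 n]: the probability
    [exp (- 3 n)] survives a union over the [4 ^ n] pairs of points. *)
Definition heavy (w : T -> R) (M : R) : set {set T} :=
  [set Q : {set T} | 2 * p * (\sum_x w x) + 2 * (3 * n%:R) * M < \sum_(x in Q) w x].

Definition max_shade : R := 2 ^+ n * expR (- (d * n%:R)).

Definition irregular : set {set T} :=
  [set Q : {set T} | exists t : T * T,
    [\/ heavy (fun y => (far t.1 y)%:R) 1 Q,
        heavy (fun z => (mid t.1 z)%:R) 1 Q,
        heavy (fun y => (shaded t.1 t.2 y)%:R) 1 Q |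
        heavy (shade t.1) max_shade Q]].

Definition crowded : set {set T} :=
  [set Q : {set T} | exists t : T * T,
    [/\ t.1 \in Q, t.2 \in Q, t.1 != t.2 & ~~ away t.1 t.2]].

(** A point [z] hides at most [2 ^ (n - dist v z)] points, and
    [exp (1 / 2) <= 2]. *)
Lemma shade_bounds v z : 0 <= shade v z <= max_shade.
Proof.
have s0 : 0 <= \sum_y (shaded v z y)%:R :> R by apply: sumr_ge0 => y _; rewrite ler0n.
apply/andP; split; first by rewrite mulr_ge0 ?ler0n.
rewrite /shade; have [az|_] := boolP (away v z); last by rewrite mul0r mulr_ge0 ?exprn_ge0 ?expR_ge0.
rewrite mul1r; apply: (@le_trans _ _ (\sum_y (between v y z)%:R)).
  apply: ler_sum => y _; rewrite ler_nat /shaded; by case: between => //; case: (~~ _).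
rewrite sum_between_end /max_shade.
have e1 : expR (1 / 2) ^+ dist v z <= 2 ^+ dist v z :> R.
  by rewrite lerXn2r ?nnegrE ?expR_ge0 ?expR_half_le2.
have -> : 2 ^+ n = 2 ^+ (n - dist v z) * 2 ^+ dist v z :> R.
  by rewrite -exprD subnK ?dist_le.
rewrite -mulrA ler_peMr ?exprn_ge0 //.
apply: (@le_trans _ _ (expR (1 / 2) ^+ dist v z * expR (- (d * n%:R)))).
  rewrite -expRM_natr -expRD -[leLHS]expR0 ler_expR.
  by move: az; rewrite /away; lra.
by rewrite ler_wpM2r ?expR_ge0.
Qed.

Hypothesis p01 : 0 <= p <= 1.

Lemma prob_heavy (w : T -> R) M : 0 < M -> (forall x, 0 <= w x <= M) ->
  prob (heavy w M) <= expR (- (3 * n%:R)).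
Proof. by move=> M0 wM; exact: prob_weight_tail. Qed.

Lemma prob_irregular : prob irregular <= 4 * expR (- n%:R).
Proof.
apply: le_trans (prob_union p01 _) _.
have natb (b : bool) : 0 <= (b%:R : R) <= 1 by case: b; rewrite ?lexx ?ler01.
have M0 : 0 < max_shade by rewrite mulr_gt0 ?exprn_gt0 ?expR_gt0.
apply: (@le_trans _ _ (\sum_(t : T * T) (4 * expR (- (3 * n%:R))))).
  apply: ler_sum => -[v z] _ /=.
  have h1 := @prob_heavy (fun y => (far v y)%:R) 1 ltr01 (fun=> natb _).
  have h2 := @prob_heavy (fun z => (mid v z)%:R) 1 ltr01 (fun=> natb _).
  have h3 := @prob_heavy (fun y => (shaded v z y)%:R) 1 ltr01 (fun=> natb _).
  have h4 := @prob_heavy (shade v) max_shade M0 (@shade_bounds v).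
  set H1 := heavy _ _ in h1; set H2 := heavy _ _ in h2.
  set H3 := heavy _ _ in h3; set H4 := heavy _ _ in h4.
  apply: (@le_trans _ _ (prob ((H1 `|` H2) `|` (H3 `|` H4)))).
    apply: le_prob => // Q /= [hQ|hQ|hQ|hQ];
      [left; left|left; right|right; left|right; right]; exact: hQ.
  have u1 := prob_union2 p01 H1 H2; have u2 := prob_union2 p01 H3 H4.
  have u3 := prob_union2 p01 (H1 `|` H2) (H3 `|` H4); lra.
rewrite sumr_const card_prod !card_ffun card_bool card_ord -[leLHS]mulr_natl.
rewrite natrM natrX mulrCA ler_pM2l //.
have -> : - (3 * n%:R) = - n%:R - 1 * n%:R - 1 * n%:R :> R by ring.
rewrite expRD expRD [expR (- (1 * _))]expRN expRM_natr.
have e2 : 2 ^+ n / expR 1 ^+ n <= 1 :> R.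
  rewrite ler_pdivrMr ?exprn_gt0 ?expR_gt0 // mul1r.
  by rewrite lerXn2r ?nnegrE ?expR_ge0 ?expR1_ge2.
have -> : 2 ^+ n * 2 ^+ n * (expR (- n%:R) / expR 1 ^+ n / expR 1 ^+ n) =
  expR (- n%:R) * (2 ^+ n / expR 1 ^+ n) * (2 ^+ n / expR 1 ^+ n) :> R by ring.
have q0 : 0 <= 2 ^+ n / expR 1 ^+ n :> R by rewrite divr_ge0 ?exprn_ge0 ?expR_ge0.
rewrite -mulrA ler_piMr ?expR_ge0 // mulr_ile1 //.
Qed.

(** First moment: there are [2 ^ n] choices of [v], and at most [exp (e n)]
    points in a ball of radius [2 * d * n = e ^ 2 / 4 * n]. *)
Lemma prob_crowded (e : R) : 0 < e -> d = e ^+ 2 / 8 ->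
  p ^+ 2 * 2 ^+ n <= expR (- (2 * e * n%:R)) ->
  prob crowded <= expR (- (e * n%:R)).
Proof.
move=> e0 de p2; apply: le_trans (prob_union p01 _) _.
apply: (@le_trans _ _ (\sum_(t : T * T) (~~ away t.1 t.2)%:R * p ^+ 2)).
  apply: ler_sum => -[v y] _ /=.
  have [a|na] := boolP (away v y).
    rewrite mul0r /random_subset_prob big_pred0 // => Q.
    by apply/asboolP => -[].
  have [<-|vy] := eqVneq v y.
    rewrite /random_subset_prob big_pred0 ?mul1r ?exprn_ge0 //; first by case/andP: p01.
    by move=> Q; apply/asboolP => -[].
  have <- : #|[set v; y]%SET| = 2%N by rewrite finset.cards2 vy.
  rewrite mul1r -prob_subset; apply: le_prob => // Q [vQ yQ _ _].
  by apply/fintype.subsetP => u; rewrite !inE => /orP[]/eqP->.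
rewrite -(pair_bigA _ (fun v y => (~~ away v y)%:R * p ^+ 2)) /=.
apply: (@le_trans _ _ (\sum_(v : T) (expR (e * n%:R) * p ^+ 2))).
  apply: ler_sum => v _; rewrite -mulr_suml ler_wpM2r ?exprn_ge0 //.
    by case/andP: p01.
  apply: le_trans (card_ball v e0); rewrite -sum1_card natr_sum.
  rewrite [leRHS]big_mkcond; apply: ler_sum => y _.
  rewrite /away -leNgt inE; have -> : 2 * d = e ^+ 2 / 4 by rewrite de; field.
  by case: ifP.
rewrite sumr_const card_ffun card_bool card_ord -[leLHS]mulr_natl natrX.
rewrite mulrCA [2 ^+ n * _]mulrC.
apply: (@le_trans _ _ (expR (e * n%:R) * expR (- (2 * e * n%:R)))).
  by rewrite ler_wpM2l ?expR_ge0.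
by rewrite -expRD ler_expR; lra.
Qed.

(** The hypothesis on [p * 2 ^ k] bounds the mean number of points of [Q] in
    the face of [v] and a point [y] that is not far. The dominant term is
    [p ^ 2] times the number of pairs [(z, y)] with [z] between [v] and [y];
    the others come from the additive errors in the concentration bounds. *)
Lemma regular_nonneighbors (e : R) (Q : {set T}) v : (0 < n)%N ->
  0 < e <= 1 -> d = e ^+ 2 / 8 ->
  (forall k : nat, k%:R <= (1 / 2 + d) * n%:R ->
     p * 2 ^+ k <= expR (- (e / 2 * n%:R))) ->
  ~ crowded Q -> ~ irregular Q -> v \in Q ->
  #|nonneighbors Q v|%:R <=
    30 * n%:R * (p * 2 ^+ n) * expR (- (d ^+ 2 / 2 * n%:R)) + 42 * n%:R ^+ 2.
Proof.
move=> n0 /andP[e0 e1] de pk ncr nir vQ.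
have n1 : 1 <= n%:R :> R by rewrite ler1n.
have p0 : 0 <= p by case/andP: p01.
have d0 : 0 <= d by rewrite de; nra.
have d8 : d <= 1 / 8 by rewrite de; nra.
have dle : d <= e / 8 by rewrite de; nra.
have d01 : 0 <= d <= 1 by rewrite d0 /=; lra.
have light w M : ~ heavy w M Q ->
    \sum_(x in Q) w x <= 2 * p * (\sum_x w x) + 2 * (3 * n%:R) * M.
  by move=> /negP; rewrite -leNgt.
have /light L1 : ~ heavy (fun y => (far v y)%:R) 1 Q.
  by move=> h; apply: nir; exists (v, v); apply: Or41.
have /light L2 : ~ heavy (fun z => (mid v z)%:R) 1 Q.
  by move=> h; apply: nir; exists (v, v); apply: Or42.
have L3 z : \sum_(y in Q) (shaded v z y)%:R <=
    2 * p * (\sum_y (shaded v z y)%:R) + 2 * (3 * n%:R) * 1.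
  by apply: light => h; apply: nir; exists (v, z); apply: Or43.
have /light L4 : ~ heavy (shade v) max_shade Q.
  by move=> h; apply: nir; exists (v, v); apply: Or44.
set m := p * 2 ^+ n; set E := expR (- (d ^+ 2 / 2 * n%:R)).
have m0 : 0 <= m by rewrite mulr_ge0 ?exprn_ge0.
have E0 : 0 <= E by exact: expR_ge0.
have sum_card (P : pred T) : \sum_y (P y)%:R = #|P|%:R :> R.
  by rewrite -sum1_card natr_sum [RHS]big_mkcond; apply: eq_bigr => y _; rewrite unfold_in; case: (P y).
have F1 : p * (\sum_y (far v y)%:R) <= m * E.
  rewrite /m -mulrA ler_wpM2l // sum_card; exact: card_far.
have F2 : p * (\sum_z (mid v z)%:R) <= m * E.
  rewrite /m -mulrA ler_wpM2l // sum_card; exact: card_near_half.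
have expE (a : R) : d ^+ 2 / 2 <= a -> expR (- (a * n%:R)) <= E.
  by move=> ha; rewrite ler_expR lerN2 ler_wpM2r ?ler0n.
have S1 : p * (\sum_z shade v z) <= 2 ^+ n * E.
  apply: (@le_trans _ _ (p * \sum_z \sum_y (shaded v z y)%:R)).
    apply: ler_wpM2l => //; apply: ler_sum => z _; rewrite /shade.
    rewrite ler_piMl ?lern1 ?leq_b1 //.
    by apply: sumr_ge0 => y _; rewrite ler0n.
  rewrite exchange_big mulr_sumr /=.
  apply: (@le_trans _ _ (\sum_(y : T) E)); last first.
    by rewrite sumr_const card_ffun card_bool card_ord -[leLHS]mulr_natl natrX.
  apply: ler_sum => y _; have [fy|nfy] := boolP (far v y).
    rewrite big1 ?mulr0 // => z _; by rewrite /shaded fy andbF.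
  under eq_bigr => z _ do rewrite /shaded nfy andbT.
  rewrite sum_between_mid; apply: le_trans (expE _ _); last first.
    by apply: (_ : _ <= e / 2); nra.
  by apply: pk; apply: ltW; rewrite ltNge.
have S2 : 2 * (3 * n%:R) * max_shade * p <= 6 * n%:R * (m * E).
  have : expR (- (d * n%:R)) <= E by apply: expE; nra.
  move=> /(ler_wpM2l (_ : 0 <= 6 * n%:R * m)) h.
  have {h} := h (mulr_ge0 (mulr_ge0 (ler0n _ _) (ler0n _ _)) m0).
  move=> h; apply: le_trans (_ : 6 * n%:R * m * expR (- (d * n%:R)) <= _); last by rewrite mulrA.
  rewrite /max_shade le_eqVlt /m.
  by apply/orP; left; apply/eqP; ring.
have := @card_nonneighbors_le Q v; move=> /(_ _ _ vQ) h.
apply: le_trans (h _ _) _; first lra.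
  move=> x y xQ yQ xy; apply: contrapT => /negP na.
  by apply: ncr; exists (x, y); split.
(* Concentration for each fixed [z], summed over the blocking [z] in [Q]. *)
have step : \sum_(z in Q | mid v z && away v z) \sum_(y in Q) (shaded v z y)%:R
    <= 2 * p * (\sum_(z in Q) shade v z) + 6 * n%:R * (\sum_(z in Q) (mid v z)%:R).
  rewrite !mulr_sumr -big_split /= big_mkcondr /=; apply: ler_sum => z _.
  have sh0 : 0 <= shade v z by case/andP: (shade_bounds v z).
  case: ifP => [/andP[mz az]|_].
    by rewrite mz /shade az mul1r mulr1; have := L3 z; lra.
  apply: addr_ge0; last by rewrite !mulr_ge0.
  by apply: mulr_ge0 sh0; lra.
apply: le_trans (lerD L1 step) _.
have b1 : 2 * p * (\sum_(z in Q) shade v z) <=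
    4 * (m * E) + 12 * n%:R * (m * E).
  have := ler_wpM2l p0 L4; have := ler_wpM2l p0 S1; move: S2; rewrite /m; lra.
have b2 : 6 * n%:R * (\sum_(z in Q) (mid v z)%:R) <=
    12 * n%:R * (m * E) + 36 * n%:R ^+ 2.
  have n6 : 0 <= 6 * n%:R :> R by rewrite mulr_ge0 ?ler0n.
  have := ler_wpM2l n6 L2; have := ler_wpM2l n6 F2; rewrite expr2; lra.
have mE : 0 <= m * E by rewrite mulr_ge0.
have nmE : m * E <= n%:R * (m * E) by rewrite ler_peMl.
have nn : n%:R <= n%:R ^+ 2 :> R by rewrite expr2 ler_peMl ?ler0n.
lra.
Qed.

End LargeP.

(** * The two regimes together *)

Section Assembly.
Variable R : realType.

(** The hypothesis on [p] in the form in which it can be combined with powers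
    of 2, written as [exp (ln 2 * k)]. *)
Lemma le_exp_of_sqrt2 (e p : R) (n : nat) : 0 < e <= 1 ->
  p <= ((1 - e) / Num.sqrt 2) ^+ n -> p <= expR (- ((e + ln 2 / 2) * n%:R)).
Proof.
move=> /andP[e0 e1] hp; apply: le_trans hp _.
have s2 : Num.sqrt 2 = expR (ln 2 / 2) :> R.
  have h : expR (ln 2 / 2) ^+ 2 = 2 :> R.
    by rewrite -expRM_natr mulfVK ?lnK ?posrE.
  by rewrite -[X in Num.sqrt X]h sqrtr_sqr ger0_norm ?expR_ge0 //.
rewrite -mulNr expRM_natr; apply: lerXn2r; rewrite ?nnegrE ?expR_ge0 //.
  by rewrite divr_ge0 ?sqrtr_ge0 // subr_ge0.
rewrite s2 opprD expRD [in leRHS]expRN [expR (- (ln 2 / 2))]expRN -[(expR e)^-1]expRN.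
rewrite ler_wpM2r ?invr_ge0 ?expR_ge0 //; exact: expR_ge1Dx.
Qed.

(** Phrased with the non-neighbors, which only depend on which points of the
    cube belong to [Q], and not with the degrees, which depend on the faces of
    the polytope. *)
Definition exceptional (n : nat) (delta : R) : set {set cube n} :=
  [set Q : {set cube n} | exists2 v, v \in Q &
     delta * (#|Q|%:R - 1) < #|nonneighbors Q v|%:R].

(** Here the number of non-neighbors is zero, up to failure probabilities
    [(2 * (11 / 20) ^ 2) ^ n] and [(6 * (11 / 20) ^ 3) ^ n]; the largest base
    is [1 - 7 / 4000], hence the condition on [c]. *)
Lemma exceptional_small (c p : R) (n : nat) (delta : R) :
  (0 < n)%N -> 0 < c <= 1 / 1000 -> 0 <= p -> p <= 1 -> p <= (11 / 20) ^+ n ->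
  0 <= delta ->
  random_subset_prob p (@exceptional n delta) <= 2 * (n%:R ^+ 2 * expR (- (c * n%:R))).
Proof.
move=> n0 /andP[c0 c1] p0 p1 pn d0.
have p01 : 0 <= p <= 1 by rewrite p0.
have n1 : 1 <= n%:R :> R by rewrite ler1n.
apply: (@le_trans _ _ (2 ^+ n * p ^+ 2 + 6 ^+ n * p ^+ 3)).
  apply: le_trans (prob_some_nonneighbor n0 p01); apply: le_prob => //.
  move=> Q [v vQ ex]; exists v => //; apply/eqP => N0.
  move: ex; rewrite N0 finset.cards0 ltNge => /negP; apply.
  apply: mulr_ge0 => //; rewrite subr_ge0 ler1n; apply/card_gt0P; by exists v.
have geo (q : R) : 0 <= q <= 1 - c -> q ^+ n <= n%:R ^+ 2 * expR (- (c * n%:R)).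
  move=> /andP[q0 q1]; apply: (@le_trans _ _ (expR (- c) ^+ n)).
    rewrite lerXn2r ?nnegrE ?expR_ge0 //; apply: le_trans q1 _; exact: expR_ge1Dx.
  by rewrite -expRM_natr mulNr ler_peMl ?expR_ge0 // exprn_ege1.
have g1 := geo (2 * (11 / 20) ^+ 2); have g2 := geo (6 * (11 / 20) ^+ 3).
have h1 : 2 ^+ n * p ^+ 2 <= (2 * (11 / 20) ^+ 2) ^+ n.
  rewrite exprMn ler_wpM2l ?exprn_ge0 // -exprM mulnC exprM.
  by rewrite lerXn2r ?nnegrE ?exprn_ge0 //; lra.
have h2 : 6 ^+ n * p ^+ 3 <= (6 * (11 / 20) ^+ 3) ^+ n.
  rewrite exprMn ler_wpM2l ?exprn_ge0 // -exprM mulnC exprM.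
  by rewrite lerXn2r ?nnegrE ?exprn_ge0 //; lra.
have c1' : 0 <= (2 * (11 / 20) ^+ 2 : R) <= 1 - c by apply/andP; split; lra.
have c2' : 0 <= (6 * (11 / 20) ^+ 3 : R) <= 1 - c by apply/andP; split; lra.
by have := g1 c1'; have := g2 c2'; lra.
Qed.

Lemma sparse_arith (N m U q x y E delta : R) :
  0 <= U -> 8 <= m -> m / 4 < q -> x * E <= U -> y <= m * U -> 600 * U <= delta ->
  N <= 30 * x * m * E + 42 * y -> N <= delta * (q - 1).
Proof.
move=> U0 m8 mq xE ym dU hN.
have m0 : 0 <= m by lra.
have h1 := ler_wpM2l m0 xE.
have q1 : m / 8 <= q - 1 by lra.
have h2 := ler_wpM2l U0 q1.
have dU0 : 0 <= delta - 600 * U by lra.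
have q0 : 0 <= q - 1 by lra.
have h3 := mulr_ge0 dU0 q0.
have h4 := mulr_ge0 m0 U0.
lra.
Qed.

(** The mean size [m = p * 2 ^ n] of [Q] is at least [exp (n / 20)], so that
    the additive errors of order [n ^ 2] are negligible as well. From
    [n >= 160] on it is at least 8, which makes [#|Q| - 1 >= m / 8] follow
    from [#|Q| > m / 4]. *)
Lemma exceptional_large (e c p : R) (n : nat) (delta : R) :
  (160 <= n)%N -> 0 < e <= 1 -> 0 < c -> c <= e / 1000 -> c <= (e ^+ 2 / 8) ^+ 2 / 2 ->
  0 <= p -> p <= 1 -> (11 / 20) ^+ n < p ->
  p <= expR (- ((e + ln 2 / 2) * n%:R)) ->
  600 * (n%:R ^+ 2 * expR (- (c * n%:R))) <= delta ->
  random_subset_prob p (@exceptional n delta) <= 9 * (n%:R ^+ 2 * expR (- (c * n%:R))).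
Proof.
move=> n160 /andP[e0 e1] c0 ce cd p0 p1 plow pup hdelta.
have p01 : 0 <= p <= 1 by rewrite p0.
have n0 : (0 < n)%N by apply: leq_trans n160.
have n1 : 160 <= n%:R :> R by rewrite ler_nat.
have /andP[L0 L1] := ln2_bounds R.
pose d : R := e ^+ 2 / 8; pose m := p * 2 ^+ n.
set U := n%:R ^+ 2 * expR (- (c * n%:R)) in hdelta *.
have d0 : 0 <= d by rewrite /d; nra.
have de : d <= e / 8 by rewrite /d; nra.
have n2 : 1 <= n%:R ^+ 2 :> R by rewrite exprn_ege1 //; lra.
have leU a : c <= a -> n%:R ^+ 2 * expR (- (a * n%:R)) <= U.
  by move=> ca; rewrite ler_wpM2l ?exprn_ge0 // ler_expR lerN2 ler_wpM2r.
have leU' a : c <= a -> expR (- (a * n%:R)) <= U.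
  by move=> ca; apply: le_trans (leU _ ca); rewrite ler_peMl ?expR_ge0.
have mlow : expR (1 / 20 * n%:R) <= m.
  rewrite expRM_natr; apply: (@le_trans _ _ ((11 / 10) ^+ n)).
    by rewrite lerXn2r ?nnegrE ?expR_ge0 ?expR_tenth_bound //; lra.
  have -> : 11 / 10 = 11 / 20 * 2 :> R by field.
  by rewrite exprMn ler_wpM2r ?exprn_ge0 // ltW.
have m8 : 8 <= m.
  by apply: le_trans mlow; apply: le_trans (expR_ge1Dx _); lra.
have n2m : n%:R ^+ 2 <= m * U.
  apply: (@le_trans _ _ (m * (n%:R ^+ 2 * expR (- (1 / 20 * n%:R))))).
    rewrite mulrCA ler_peMr ?exprn_ge0 // expRN.
    by rewrite ler_pdivlMr ?expR_gt0 // [1 * expR _]mul1r.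
  by rewrite ler_wpM2l ?leU //; lra.
have sqr_bound : p ^+ 2 * 2 ^+ n <= expR (- (2 * e * n%:R)).
  have -> : 2 ^+ n = expR (ln 2 * n%:R) :> R by rewrite expRM_natr lnK ?posrE.
  apply: (@le_trans _ _ (expR (- ((e + ln 2 / 2) * n%:R)) ^+ 2 * expR (ln 2 * n%:R))).
    by rewrite ler_wpM2r ?expR_ge0 // lerXn2r ?nnegrE ?expR_ge0.
  by rewrite -expRM_natr -expRD ler_expR; lra.
have pow_bound (k : nat) : k%:R <= (1 / 2 + d) * n%:R ->
    p * 2 ^+ k <= expR (- (e / 2 * n%:R)).
  move=> hk; have -> : 2 ^+ k = expR (ln 2 * k%:R) :> R by rewrite expRM_natr lnK ?posrE.
  apply: (@le_trans _ _ (expR (- ((e + ln 2 / 2) * n%:R)) * expR (ln 2 * k%:R))).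
    by rewrite ler_wpM2r ?expR_ge0.
  rewrite -expRD ler_expR.
  have h1 := ler_wpM2l L0 hk.
  have nn0 : 0 <= n%:R :> R by rewrite ler0n.
  have h2 : ln 2 * (d * n%:R) <= d * n%:R by apply: ler_piMl => //; exact: mulr_ge0.
  have h3 : d * n%:R <= e / 8 * n%:R by rewrite ler_wpM2r.
  have h4 : 0 <= e * n%:R by apply: mulr_ge0 => //; exact: ltW.
  lra.
apply: (@le_trans _ _ (random_subset_prob p
    ((@crowded R n d `|` @irregular R n d p) `|`
     [set Q : {set cube n} | #|Q|%:R <= m / 4]))).
  apply: le_prob => // Q [v vQ ex]; apply: contrapT => /not_orP[/not_orP[ncr nir] /= big].
  have {}big : m / 4 < #|Q|%:R by rewrite ltNge; apply/negP.
  have e01 : 0 < e <= 1 by rewrite e0.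
  have h := regular_nonneighbors p01 n0 e01 (erefl _ : d = e ^+ 2 / 8) pow_bound ncr nir vQ.
  rewrite -/m in h.
  have nE := leU _ cd.
  have nn : n%:R * expR (- (d ^+ 2 / 2 * n%:R)) <= U.
    apply: le_trans nE; rewrite ler_wpM2r ?expR_ge0 // expr2 ler_peMl //; lra.
  have U0 : 0 <= U by rewrite mulr_ge0 ?exprn_ge0 ?expR_ge0.
  move: ex; rewrite ltNge => /negP; apply.
  exact: (sparse_arith U0 m8 big nn n2m hdelta h).
apply: le_trans (prob_union2 p01 _ _) _.
have p1' := prob_union2 p01 (@crowded R n d) (@irregular R n d p).
have p2' := prob_crowded p01 e0 (erefl _ : d = e ^+ 2 / 8) sqr_bound.
have p3' := prob_irregular n d p01.
have p4' := prob_small_card n p01 (m / 4).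
have U1 : expR (- (e * n%:R)) <= U by apply: leU'; lra.
have U2 : expR (- n%:R) <= U by rewrite -[n%:R]mul1r; apply: leU'; lra.
have U3 : expR (m / 4 - p * 2 ^+ n / 2) <= 4 * U.
  rewrite -/m; have -> : m / 4 - m / 2 = - (m / 4) by field.
  have h1 := @expR_ge1Dx R (m / 4).
  have h2 := leU' (1 / 20) (_ : c <= 1 / 20).
  apply: (@le_trans _ _ (4 / m)).
    rewrite expRN -div1r ler_pdivrMr ?expR_gt0 // mulrAC ler_pdivlMr; lra.
  rewrite ler_wpM2l //; apply: le_trans (h2 _); last lra.
  by rewrite expRN lef_pV2 ?posrE ?expR_gt0 //; lra.
lra.
Qed.

(** The constant is uniform in [p]; for each [n] either regime may apply, and
    [n < 160] is absorbed by making the bound at least 1. *)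
Lemma exceptional_prob (e : R) : 0 < e <= 1 ->
  exists2 K : R, 0 <= K & forall (n : nat) (p : R), (0 < n)%N -> 0 <= p <= 1 ->
    p <= ((1 - e) / Num.sqrt 2) ^+ n ->
    random_subset_prob p (@exceptional n (K * harmonic n)) <= K * harmonic n.
Proof.
move=> /andP[e0 e1]; pose c := e ^+ 4 / 1000.
have e4 : e ^+ 4 <= e by rewrite exprS ger_pMr // exprn_ile1 // ltW.
have e40 : 0 < e ^+ 4 by rewrite exprn_gt0.
have c0 : 0 < c by rewrite /c; lra.
have ce : c <= e / 1000 by rewrite /c; lra.
have cd : c <= (e ^+ 2 / 8) ^+ 2 / 2.
  by rewrite expr_div_n -exprM /c; lra.
pose K0 := 54 / c ^+ 3.
have K054 : 54 <= K0.
  by rewrite ler_pdivlMr ?exprn_gt0 // ler_piMr // exprn_ile1 //; lra.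
exists (600 * K0) => [|n p n0 p01 pn]; first lra.
have := sqr_mul_expRN_le c0 n0; rewrite -/K0.
set U := _ * expR _ => hU.
have U0 : 0 <= U by rewrite mulr_ge0 ?exprn_ge0 ?expR_ge0.
have h0 : 0 <= harmonic n :> R by rewrite invr_ge0.
have Kh0 : 0 <= K0 * harmonic n by rewrite mulr_ge0 //; lra.
have /andP[p0 p1] := p01.
have [psmall|plarge] := leP p ((11 / 20) ^+ n).
  apply: le_trans (exceptional_small n0 (c := c) _ p0 p1 psmall _) _; rewrite -?/U; lra.
have [n160|n160] := leqP 160 n.
  apply: le_trans (exceptional_large n160 _ c0 ce cd p0 p1 plarge _ _) _; rewrite -?/U.
  - by rewrite e0.
  - by apply: le_exp_of_sqrt2 => //; rewrite e0.
  - lra.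
  - lra.
apply: (@le_trans _ _ 1).
  by rewrite -(prob_setT n p); apply: le_prob.
have h160 : 1 / 161 <= harmonic n :> R.
  rewrite div1r lef_pV2 ?posrE // ler_nat ltnW //.
have := ler_pM (_ : 0 <= 54) (_ : 0 <= 1 / 161) K054 h160.
lra.
Qed.

End Assembly.

(** * Passing to the limit *)

Section Limits.
Variable R : realType.

Lemma whp_of_le (p : nat -> R) (E : forall n, set {set cube n}) (f : nat -> R) :
  (forall n, (0 < n)%N -> 0 <= p n <= 1) -> f @ \oo --> (0 : R) ->
  (forall n, (0 < n)%N -> random_subset_prob (p n) (~` E n) <= f n) ->
  whp p E.
Proof.
move=> p01 f0 Ef; apply: (@squeeze_cvgr _ _ _ _ (fun n => 1 - f n) (fun=> 1)).
- exists 1%N => // n /= n0; have := Ef n n0; rewrite prob_setC ?p01 // => hf.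
  apply/andP; split; first lra.
  by rewrite -(prob_setT n (p n)); apply: le_prob => //; exact: p01.
- by rewrite -[X in _ --> X]subr0; apply: cvgB => //; exact: cvg_cst.
- exact: cvg_cst.
Qed.

(** If every row tends to 0, so does a suitable diagonal: [k n] is the largest
    [i <= n] whose row is at most [1 / (i + 1)] at [n]. *)
Lemma diagonal_threshold (a : nat -> nat -> R) :
  (forall n, a 0 n <= 1) -> (forall K, a K @ \oo --> (0 : R)) ->
  exists k : nat -> nat, (forall n, a (k n) n <= harmonic (k n)) /\
    (fun n => harmonic (k n)) @ \oo --> (0 : R).
Proof.
move=> a0 acvg; pose P n (i : 'I_n.+1) := a i n <= harmonic i.
have P0 n : P n ord0 by rewrite /P /= invr1.
pose k n : nat := [arg max_(i > ord0 | P n i) (i : nat)].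
exists k; split=> [n|]; first by rewrite /k; case: arg_maxnP.
apply/cvgr0Pnorm_le => e e0.
have [M _ hM] := (cvgr0Pnorm_le (@harmonic R)).1 cvg_harmonic e e0.
have hpos : 0 < harmonic M :> R by exact: harmonic_gt0.
have [N _ hN] := (cvgr0Pnorm_le (a M)).1 (acvg M) _ hpos.
exists (maxn M N) => // n /= ; rewrite geq_max => /andP[Mn Nn].
have PM : P n (inord M).
  rewrite /P inordK ?ltnS //; apply: le_trans (hN n Nn); exact: ler_norm.
have Mk : (M <= k n)%N.
  by rewrite /k; case: arg_maxnP => // i _ /(_ _ PM); rewrite inordK.
exact: hM.
Qed.

End Limits.

Theorem theorem1p4 (R : realType) (eps : R) (p : nat -> R) :
  0 < eps ->
  (forall n : nat, (0 < n)%N -> 0 <= p n <= 1) ->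
  (forall n : nat, (0 < n)%N -> p n <= ((1 - eps) / Num.sqrt 2) ^+ n) ->
  (* deg(v) = (1 - o(1)) |V| *)
  (vertices_unbounded p ->
   exists delta : nat -> R, delta @ \oo --> (0 : R) /\
     whp p (fun n => [set Q : {set cube n} |
       forall v, v \in Q -> exists e : R, `|e| <= delta n /\
         (deg R Q v)%:R = (1 - e) * #|Q|%:R])) /\
  (* for every p: deg(v) = (1 - o(1)) (|V| - 1) *)
  (exists delta : nat -> R, delta @ \oo --> (0 : R) /\
     whp p (fun n => [set Q : {set cube n} |
       forall v, v \in Q -> exists e : R, `|e| <= delta n /\
         (deg R Q v)%:R = (1 - e) * (#|Q|%:R - 1)])).
Proof.
move=> eps0 p01 pn.
(* For [n = 1] the hypotheses make [(1 - eps) / sqrt 2] nonnegative. *)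
have eps1 : eps <= 1.
  have s0 : 0 < Num.sqrt 2 :> R by rewrite sqrtr_gt0.
  have := pn 1%N isT; have /andP[q0 _] := p01 1%N isT; rewrite expr1 => /(le_trans q0).
  by rewrite pmulr_lge0 ?invr_gt0 // subr_ge0.
have eps01 : 0 < eps <= 1 by rewrite eps0.
have [K K0 hK] := exceptional_prob eps01.
pose del n := K * harmonic n.
have delcvg : del @ \oo --> (0 : R).
  by rewrite -[X in _ --> X](mulr0 K); apply: cvgM; [exact: cvg_cst | exact: cvg_harmonic].
have del0 n : 0 <= del n by rewrite mulr_ge0 // ltW // harmonic_gt0.
have excP n : (0 < n)%N -> random_subset_prob (p n) (@exceptional R n (del n)) <= del n.
  by move=> n0; apply: hK => //; [exact: p01 | exact: pn].
have sandwich n (Q : {set cube n}) v : ~ @exceptional R n (del n) Q -> v \in Q ->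
    (deg R Q v)%:R + 1 <= #|Q|%:R :> R /\
    #|Q|%:R - 1 - (deg R Q v)%:R <= del n * (#|Q|%:R - 1).
  move=> nex vQ; split; first by rewrite natr1 ler_nat -addn1 deg_le.
  have h : #|nonneighbors Q v|%:R <= del n * (#|Q|%:R - 1).
    by rewrite leNgt; apply/negP => h; apply: nex; exists v.
  have := le_deg_nonneighbors R vQ; rewrite -(ler_nat R) !natrD; lra.
split; last first.
  exists del; split => //; apply: (whp_of_le p01 delcvg) => n n0.
  apply: le_trans (excP n n0); apply: le_prob; first exact: p01.
  move=> Q /= nQ; apply: contrapT => nex; apply: nQ => v vQ.
  have [h1 h2] := sandwich n Q v nex vQ.
  set D := (deg R Q v)%:R in h1 h2 *; set q := #|Q|%:R in h1 h2 *.
  have D0 : 0 <= D by rewrite ler0n.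
  have [q1|q1] := eqVneq (q - 1) 0.
    by exists 0; rewrite normr0 del0 q1 mulr0; split => //; lra.
  have qpos : 0 < q - 1 by rewrite lt_neqAle eq_sym q1 /=; lra.
  exists (1 - D / (q - 1)); split; last by field.
  rewrite ger0_norm; first by rewrite lerBlDr -lerBlDl ler_pdivlMr //; lra.
  by rewrite subr_ge0 ler_pdivrMr // mul1r; lra.
move=> unb.
pose small k n := random_subset_prob (p n) [set Q : {set cube n} | (0 < #|Q| <= k)%N].
have small0 n : small 0%N n <= 1.
  rewrite /small /random_subset_prob big_pred0 ?ler01 // => Q; apply/asboolP => /=.
  by case: #|Q|.
have [k [hk kcvg]] := diagonal_threshold small0 unb.
have del2cvg : (fun n => del n + harmonic (k n)) @ \oo --> (0 : R).
  by rewrite -[X in _ --> X](addr0 0); apply: cvgD.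
exists (fun n => del n + harmonic (k n)); split => //.
apply: (whp_of_le p01 del2cvg) => n n0.
apply: (@le_trans _ _ (random_subset_prob (p n) (@exceptional R n (del n) `|`
    [set Q : {set cube n} | (0 < #|Q| <= k n)%N]))); last first.
  by apply: le_trans (prob_union2 (p01 n n0) _ _) (lerD (excP n n0) (hk n)).
apply: le_prob; first exact: p01.
move=> Q /= nQ; apply: contrapT => /not_orP[nex /negP big]; apply: nQ => v vQ.
have [h1 h2] := sandwich n Q v nex vQ.
have Q0 : (0 < #|Q|)%N by apply/card_gt0P; exists v.
have kQ : harmonic (k n) * #|Q|%:R >= 1 :> R.
  move: big; rewrite Q0 /= -ltnNge => kQ.
  by rewrite mulrC /harmonic ler_pdivlMr ?ltr0n // mul1r ler_nat.
set D := (deg R Q v)%:R in h1 h2 *; set q := #|Q|%:R in h1 h2 kQ *.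
have qpos : 0 < q by rewrite ltr0n.
have D0 : 0 <= D by rewrite ler0n.
have dn := del0 n.
have e_le : 1 - D / q <= del n + harmonic (k n).
  by rewrite lerBlDr -lerBlDl ler_pdivlMr //; lra.
exists (1 - D / q); split; last by field; rewrite gt_eqF.
rewrite ger0_norm //; by rewrite subr_ge0 ler_pdivrMr // mul1r; lra.
Qed.
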